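(* Let $q\in\mathbb{T}\setminus\{1\}$ and let $\mathcal{J}$ be one of the index sets $\{0,1,2,\dots\}$, $\{0,-1,-2,\dots\}$, or $\mathbb{Z}$. Let $(S,T)$ be a $q$-commuting pair on a Hilbert space $H$, let $\alpha\neq0$ be an eigenvalue of $S$, and suppose that $q^i\alpha$, $i\in\mathcal{J}$, are pairwise different eigenvalues of $S$ (so $q^i\ne1$ for $i\neq 0$), and that, with respect to the (not necessarily orthogonal) decomposition of $H$ into the generalized eigenspaces $H_{S,q^i\alpha}$, $i\in\mathcal{J}$, arranged in increasing order of $i$, $S$ is block diagonal with diagonal blocks $J_{S,q^i\alpha}$; for example, for $\mathcal{J}=\{0,1,2,\dots\}$, $$S=\begin{pmatrix}J_{S,\alpha}&0&\cdots\\ 0&J_{S,q\alpha}&\ddots\\ \vdots&\ddots&\ddots\end{pmatrix}.$$ Then, with respect to this decomposition, the only possibly nonzero blocks of $T$ are those immediately below the diagonal, namely $$T_i:H_{S,q^{i-1}\alpha}\to H_{S,q^i\alpha},\qquad i-1,i\in\mathcal{J}.$$ For example, for $\mathcal{J}=\{0,1,2,\dots\}$, $$T=\begin{pmatrix}0&\cdots&\cdots&\cdots\\ T_1&0&\ddots&\ddots\\0&T_2&\ddots&\ddots\\ \vdots&\ddots&\ddots&\ddots\end{pmatrix}.$$ Moreover, suppose that for a given $i$ with $i-1,i\in\mathcal{J}$ each of the eigenvalues $q^{i-1}\alpha$ and $q^i\alpha$ has a unique Jordan block. Let $x_1,\dots,x_k$ be a Jordan basis of $H_{S,q^{i-1}\alpha}$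 (so $(S-q^{i-1}\alpha I)x_1=0$ and $(S-q^{i-1}\alpha I)x_j=x_{j-1}$ for $j\ge2$), and let $0\le l\le k$ be the largest number such that $Tx_l=0$ (with $l=0$ if $Tx_1\ne0$). Then, taking the basis of $H_{S,q^i\alpha}$ consisting of a full sequence of generalized eigenvectors $Tx_{l+1},\bar q\,Tx_{l+2},\dots,\bar q^{\,k-l-1}Tx_k,y_1,\dots,y_j$, we get $$T_i=\begin{pmatrix}0&\mathrm{diag}(1,q,\dots,q^{k-l-1})\\0&0\end{pmatrix},$$ where the $0$'s are zero matrices of the respective sizes.
   Context: A pair $(S,T)$ of bounded operators on $H$ is $q$-commuting ($|q|=1$) if $ST=qTS$. For $\beta\in\mathbb{C}$, $H_{S,\beta}$ is the generalized eigenspace of $S$ for $\beta$ (spanned by the generalized eigenvectors, i.e. the vectors annihilated by some power of $S-\beta I$), and $J_{S,\beta}$ is the part of the Jordan matrix of $S$ corresponding to $\beta$, possibly consisting of several Jordan blocks. *)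

(* Defs.v *)
From mathcomp Require Export all_boot all_order all_algebra.
From mathcomp Require Export complex.
From mathcomp Require Export all_classical all_reals topology normedtype sequences.
Set Implicit Arguments.
Unset Strict Implicit.
Unset Printing Implicit Defensive.
Import Order.TTheory GRing.Theory Num.Theory.
Import numFieldNormedType.Exports.
Local Open Scope classical_set_scope.
Local Open Scope ring_scope.

Section LinearAlgebra.
Variables (C : fieldType) (H : lmodType C).
Implicit Types (A : H -> H) (b : C) (V : set H).

Definition sub_scalar A b : H -> H := fun x => A x - b *: x.

Definition is_eigenvalue A b : Prop := exists2 x, x != 0 & A x = b *: x.

(* For linear A this set is already a linear subspace, so no linear span is
   taken. *)
Definition geigenspace A b : set H :=
  [set x | exists n, iter n (sub_scalar A b) x = 0].

(* Algebraic (Hamel) basis of V; the index type may be infinite. *)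
Definition basis_of_set V (I : choiceType) (e : I -> H) : Prop :=
  [/\ forall i, V (e i),
      forall (s : seq I) (c : I -> C), uniq s ->
        \sum_(i <- s) c i *: e i = 0 -> forall i, i \in s -> c i = 0
    & forall v, V v ->
        exists (s : seq I) (c : I -> C), v = \sum_(i <- s) c i *: e i].

(* Indices start at 0: (A - b) x_0 = 0 and (A - b) x_(j+1) = x_j. *)
Definition jordan_chain A b n (x : 'I_n -> H) : Prop :=
  (forall j : 'I_n, j = 0 :> nat -> sub_scalar A b (x j) = 0) /\
  (forall j j' : 'I_n, j' = j.+1 :> nat -> sub_scalar A b (x j') = x j).

Definition jordan_basis A b V n (x : 'I_n -> H) : Prop :=
  jordan_chain A b x /\ basis_of_set V x.

(* In some basis of V, A acts as a Jordan matrix with the single eigenvalue b;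
   each k : K is one Jordan block, of size n k, and K may be infinite. *)
Definition has_jordan_matrix A b V : Prop :=
  exists (K : choiceType) (n : K -> nat) (e : forall k, 'I_(n k) -> H),
    [/\ forall k, (0 < n k)%N,
        forall k, jordan_chain A b (e k)
      & basis_of_set V (fun p : {k : K & 'I_(n k)} => e (tag p) (tagged p))].

Definition unique_jordan_block A b V : Prop :=
  exists n (x : 'I_n -> H), jordan_basis A b V x.

Definition is_matrix_of A m n (x : 'I_n -> H) (z : 'I_m -> H)
    (M : 'M[C]_(m, n)) : Prop :=
  forall c, A (x c) = \sum_r M r c *: z r.

(* The vectors of the chain are x_1, ..., x_k in the mathematical text, and x_j
   is here x applied to the ordinal j - 1. *)
Definition last_null A k (x : 'I_k -> H) (l : nat) : Prop :=
  (l = 0 \/ exists2 j : 'I_k, l = j.+1 & A (x j) = 0) /\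
  (forall j : 'I_k, A (x j) = 0 -> (j < l)%N).

(* A x_(l+1), c A x_(l+2), ..., c^(k-l-1) A x_k, y_1, ..., y_j *)
Definition extended_image A (c : C) k (x : 'I_k -> H) l (hl : (l <= k)%N)
    j (y : 'I_j -> H) : 'I_((k - l) + j) -> H :=
  fun r => match fintype.split r with
           | inl s => c ^+ s *: A (x (cast_ord (subnKC hl) (rshift l s)))
           | inr t => y t
           end.

Definition geigenspaces A (q a : C) (i : int) : set H :=
  geigenspace A (q ^ i * a).

End LinearAlgebra.

(* The block matrix (0 diag(1, q, ..., q^(k-l-1)); 0 0), with k-l+j rows and k
   columns. *)
Definition shifted_diag (C : fieldType) (q : C) k l (hl : (l <= k)%N) j :
    'M[C]_((k - l) + j, k) :=
  castmx (erefl, subnKC hl)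
    (block_mx (0 : 'M_(k - l, l)) (diag_mx (\row_(s < k - l) q ^+ s)) 0 0).

Section Decomposition.
Variables (C : numFieldType) (H : normedModType C).
Implicit Types (J : set int) (V : int -> set H) (y : int -> H).

(* Sum of y_i over - m <= i < n. *)
Definition bipartial_sum y (mn : nat * nat) : H :=
  \sum_(i < mn.1) y (- i.+1%:Z) + \sum_(i < mn.2) y i%:Z.

(* The series of the y_i, i in J, in increasing order of i, converges to x; a
   two-sided series is summed with both ends tending to infinity
   independently. *)
Definition expansion J V (x : H) y : Prop :=
  [/\ forall i, J i -> V i (y i),
      forall i, ~ J i -> y i = 0
    & bipartial_sum y mn @[mn --> filter_prod \oo \oo] --> x].

Definition decomposition J V : Prop :=
  forall x, exists! y, expansion J V x y.

(* Projection to the i-th summand; only meaningful when decomposition J V. *)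
Definition coord J V (i : int) (x : H) : H :=
  xget (fun=> 0) [set y | expansion J V x y] i.

(* The (i, j) block V_j -> V_i, extended by 0 on the other summands. *)
Definition block J V (A : H -> H) (i j : int) : H -> H :=
  fun x => coord J V i (A (coord J V j x)).

Definition block_diagonal_jordan J V (A : H -> H) (b : int -> C) : Prop :=
  (forall i j, J i -> J j -> i <> j ->
     forall x, V j x -> block J V A i j x = 0) /\
  (forall i, J i -> has_jordan_matrix (block J V A i i) (b i) (V i)).

End Decomposition.

(* Main.v *)
From HB Require Import structures.
Require Import Defs.
From mathcomp Require Import zify.
Set Implicit Arguments.
Unset Strict Implicit.
Unset Printing Implicit Defensive.
Import Order.TTheory GRing.Theory Num.Theory.
Import numFieldNormedType.Exports.
Local Open Scope classical_set_scope.
Local Open Scope ring_scope.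

(** From [S T = q T S] one gets [(S - q b) T = q T (S - b)], hence
    [(S - q b)^n T = q^n T (S - b)^n]: [T] sends the generalized eigenspace of
    [S] for [b] into the one for [q b] ([geigenspace_qcomm]).  With
    [V_i] the generalized eigenspace for [q^i alpha] this says that
    [T V_j] lies in [V_(j+1)].

    For the block structure it remains to see that a vector [x] of [V_(j+1)] has
    zero component in [V_i] for every [i] in [J] other than [j + 1].  If [j + 1]
    is in [J] this is uniqueness of the expansion, but for
    [J = {0, -1, -2, ...}] and [j = 0] it is not, and one has to show that [T]
    vanishes on [V_0].  Both cases are settled by [coord_geigenspace_eq0]: if
    [(S - b)^n x = 0], then, [S] being continuous, applying [(S - b)^n] termwise
    to the expansion of [x] gives an expansion of [0]; so each component of [x]
    is a generalized eigenvector for [b] as well as for its own eigenvalue, and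
    thus vanishes when these differ.  They do differ, because distinctness of
    the [q^i alpha] for [i] in [J] already forces [q^d <> 1] for all nonzero
    integers [d] ([eigenvalue_orbit_inj]).

    For the second part, the vectors [conj q^s T x_(l+1+s)] form a Jordan chain
    for [q^i alpha] by the same commutation relation ([jordan_chain_image]), and
    its first vector is nonzero by maximality of [l].  In a space with a single
    Jordan block of size [n], every chain of length [m] with nonzero first
    vector extends to a Jordan basis ([extend_jordan_chain]): with
    [N = S - q^i alpha], the last vector [t] of the chain is killed by [N^m],
    hence is of the form [N^(n-m) u'], and the vectors [N^(n-1-r) u'] are the
    required basis.  The matrix of [T] in such bases is then read off
    ([image_shifted_diag]), since [T x_1 = ... = T x_l = 0] and
    [q conj q = 1]. *)

(** * Generalized eigenspaces and q-commutation *)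

Lemma sub_scalar_is_linear (C : fieldType) (H : lmodType C)
    (A : {linear H -> H}) (b : C) : linear (sub_scalar A b).
Proof.
move=> c x y; rewrite /sub_scalar linearP scalerDr scalerBr !scalerA.
by rewrite (mulrC c) opprD addrACA.
Qed.

HB.instance Definition _ (C : fieldType) (H : lmodType C) (A : {linear H -> H})
    (b : C) := GRing.isLinear.Build C H H *:%R (sub_scalar A b)
      (@sub_scalar_is_linear C H A b).

Lemma iter_is_linear (C : fieldType) (H : lmodType C) (A : {linear H -> H})
    (n : nat) : linear (iter n A).
Proof. by elim: n => [|n IHn] c x y //=; rewrite IHn linearP. Qed.

HB.instance Definition _ (C : fieldType) (H : lmodType C) (A : {linear H -> H})
    (n : nat) := GRing.isLinear.Build C H H *:%R (iter n A)
      (@iter_is_linear C H A n).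

Lemma sub_scalarC (C : fieldType) (H : lmodType C) (A : {linear H -> H})
    (a b : C) (x : H) :
  sub_scalar A a (sub_scalar A b x) = sub_scalar A b (sub_scalar A a x).
Proof.
have AZ c v : A (c *: v) = c *: A v by exact: linearZ.
rewrite /sub_scalar !(linearB A) !AZ !scalerBr !scalerA (mulrC a) !opprB !addrA.
by rewrite addrAC [X in X + _ = _]addrAC [RHS]addrAC.
Qed.

Lemma geigenspace_inv (C : fieldType) (H : lmodType C) (A : {linear H -> H})
    (a b : C) (x : H) :
  geigenspace A a x -> geigenspace A a (sub_scalar A b x).
Proof.
move=> [n xn]; exists n.
have -> : iter n (sub_scalar A a) (sub_scalar A b x) =
          sub_scalar A b (iter n (sub_scalar A a) x).
  by elim: n {xn} => //= n ->; rewrite sub_scalarC.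
by rewrite xn linear0.
Qed.

(** On a true eigenvector for [a], the power [(A - b)^m] acts as [(a - b)^m],
    which is nonzero; the general case follows by induction on the exponent [n]
    with [(A - a)^n x = 0], applied to [(A - a) x]. *)
Lemma geigenspace_disjoint (C : fieldType) (H : lmodType C)
    (A : {linear H -> H}) (a b : C) (x : H) :
  a != b -> geigenspace A a x -> geigenspace A b x -> x = 0.
Proof.
move=> neq_ab [n]; elim: n x => [//|n IHn] x; rewrite iterSr => xn xb.
have {IHn}/eqP := IHn _ xn (geigenspace_inv a xb).
rewrite subr_eq0 => /eqP Ax; have [m] := xb.
have -> : iter m (sub_scalar A b) x = (a - b) ^+ m *: x.
  elim: m => [|m IHm]; first by rewrite scale1r.
  by rewrite iterS IHm linearZ /= /sub_scalar Ax -scalerBl scalerA exprSr.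
by move/eqP; rewrite scaler_eq0 expf_eq0 subr_eq0 (negPf neq_ab) andbF => /eqP.
Qed.

Lemma geigenspace0 (C : fieldType) (H : lmodType C) (A : H -> H) (b : C) :
  geigenspace A b 0.
Proof. by exists 0. Qed.

Lemma sub_scalar_qcomm (C : fieldType) (H : lmodType C) (S T : {linear H -> H})
    (q b : C) (x : H) :
  (forall x, S (T x) = q *: T (S x)) ->
  sub_scalar S (q * b) (T x) = q *: T (sub_scalar S b x).
Proof.
move=> ST; have TZ : T (b *: x) = b *: T x by exact: linearZ.
by rewrite /sub_scalar ST (linearB T) TZ scalerBr scalerA.
Qed.

Lemma geigenspace_qcomm (C : fieldType) (H : lmodType C) (S T : {linear H -> H})
    (q b : C) (x : H) :
  (forall x, S (T x) = q *: T (S x)) ->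
  geigenspace S b x -> geigenspace S (q * b) (T x).
Proof.
move=> ST [n xn]; exists n.
have -> : iter n (sub_scalar S (q * b)) (T x) =
          q ^+ n *: T (iter n (sub_scalar S b) x).
  elim: n {xn} => [|n IHn]; first by rewrite scale1r.
  by rewrite !iterS IHn linearZ /= sub_scalar_qcomm // scalerA exprSr.
by rewrite xn linear0 scaler0.
Qed.

Lemma geigenspaces_succ (C : fieldType) (H : lmodType C)
    (S T : {linear H -> H}) (q a : C) (j : int) (x : H) :
  q != 0 -> (forall x, S (T x) = q *: T (S x)) ->
  geigenspaces S q a j x -> geigenspaces S q a (j + 1) (T x).
Proof.
move=> q0 ST /(geigenspace_qcomm ST).
by rewrite /geigenspaces expfzDr // expr1z mulrA (mulrC q).
Qed.

(** * Expansions along the decomposition *)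

Lemma bipartial_sum_linear (C : numFieldType) (H : normedModType C)
    (A : {linear H -> H}) (y : int -> H) (mn : nat * nat) :
  A (bipartial_sum y mn) = bipartial_sum (A \o y) mn.
Proof. by rewrite /bipartial_sum linearD !linear_sum. Qed.

Lemma expansion_linear (C : numFieldType) (H : normedModType C) (J : set int)
    (V : int -> set H) (A : {linear H -> H}) (x : H) (y : int -> H) :
  continuous A -> (forall i v, V i v -> V i (A v)) ->
  expansion J V x y -> expansion J V (A x) (A \o y).
Proof.
move=> cA AV [yV y0 yx]; split=> [i Ji|i Ji|]; first exact/AV/yV.
  by rewrite /= y0 // linear0.
under eq_fun do rewrite -bipartial_sum_linear.
by apply: (@cvg_comp _ _ _ (bipartial_sum y) A _ _ _ yx); apply: cA.
Qed.

Lemma expansion_single (C : numFieldType) (H : normedModType C) (J : set int)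
    (V : int -> set H) (j : int) (x : H) :
  (forall i, V i 0) -> J j -> V j x ->
  expansion J V x (fun i => if i == j then x else 0).
Proof.
move=> V0 Jj Vx; split=> [i Ji|i Ji|]; first by case: eqP => [->|].
  by case: eqP => // ij; case: Ji; rewrite ij.
apply: (cvg_near_cst).
exists ([set m | (`|j| < m)%N], [set n | (`|j| < n)%N]).
  by split; apply: nbhs_infty_gt.
move=> [m n] /= [jm jn]; rewrite /bipartial_sum [(m, n).1]/= [(m, n).2]/=.
have [j0|j0] := leP 0 j.
  rewrite big1 ?add0r => [|i _]; last by case: ifP => // /eqP; lia.
  rewrite (bigD1 (Ordinal jn)) //= gez0_abs // eqxx big1 ?addr0 // => i.
  by rewrite -val_eqE /=; case: ifP => // /eqP; lia.
have km : (`|j|.-1 < m)%N by lia.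
rewrite [X in _ + X]big1 ?addr0 => [|i _]; last by case: ifP => // /eqP; lia.
rewrite (bigD1 (Ordinal km)) //= ifT; last by apply/eqP; lia.
rewrite big1 ?addr0 // => i.
by rewrite -val_eqE /=; case: ifP => // /eqP; lia.
Qed.

Lemma coord_expansion (C : numFieldType) (H : normedModType C) (J : set int)
    (V : int -> set H) (x : H) :
  decomposition J V -> expansion J V x (fun i => coord J V i x).
Proof. by move=> /(_ x)[y [yx _]]; apply: (xgetPex (fun=> 0) (ex_intro _ y yx)). Qed.

Lemma coord_unique (C : numFieldType) (H : normedModType C) (J : set int)
    (V : int -> set H) (x : H) (y : int -> H) (i : int) :
  decomposition J V -> expansion J V x y -> coord J V i x = y i.
Proof.
move=> dec xy; have [z [_ uniq]] := dec x.
by rewrite -(uniq _ xy) (uniq _ (coord_expansion x dec)).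
Qed.

Lemma coord_id (C : numFieldType) (H : normedModType C) (J : set int)
    (V : int -> set H) (j : int) (x : H) :
  decomposition J V -> (forall i, V i 0) -> J j -> V j x -> coord J V j x = x.
Proof.
move=> dec V0 Jj Vx.
by rewrite (coord_unique _ dec (expansion_single V0 Jj Vx)) eqxx.
Qed.

(** The number [b] may be outside the family [a]; this is what shows that [T]
    kills the last summand when [J] is bounded above.  Applying [(S - b)^n]
    termwise to the expansion of [x] yields an expansion of [0], so that the
    [i]-th component of [x] is also a generalized eigenvector for [b]. *)
Lemma coord_geigenspace_eq0 (C : numFieldType) (H : normedModType C)
    (J : set int) (S : {linear H -> H}) (a : int -> C) (b : C) (i : int)
    (x : H) :
  continuous S -> decomposition J (fun i => geigenspace S (a i)) ->
  J i -> b != a i -> geigenspace S b x ->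
  coord J (fun i => geigenspace S (a i)) i x = 0.
Proof.
move=> cS dec Ji bai xb; set V := fun i : int => _ in dec *.
have [n xn] := xb; have [Vc _ _] := coord_expansion x dec.
apply: (geigenspace_disjoint bai _ (Vc i Ji)); exists n.
pose B := iter n (sub_scalar S b).
have cN : continuous (sub_scalar S b).
  by move=> v; apply: cvgB; [apply: cS | apply: cvgZl_tmp; apply: cvg_id].
have cB : continuous B.
  rewrite /B; elim: n {xn B} => [|n IHn] v; first exact: cvg_id.
  by apply: (@continuous_comp _ _ _ (iter n _) (sub_scalar S b));
    [apply: IHn | apply: cN].
have BV k v : V k v -> V k (B v).
  by rewrite /B; elim: n {xn B cB} => //= m IHm /IHm; apply: geigenspace_inv.
have e1 := expansion_linear cB BV (coord_expansion x dec).
have e0 : expansion J V (B x) (fun=> 0).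
  rewrite /B xn; split=> [k _||] //; first exact: geigenspace0.
  by apply: cvg_near_cst; apply: nearW => mn; rewrite /bipartial_sum !big1_eq addr0.
by rewrite -[RHS](coord_unique i dec e0) (coord_unique i dec e1).
Qed.

(** * Single Jordan blocks *)

(** In the definition of a basis, a spanning list may repeat indices and the
    coefficients are indexed by the elements of a list; over a finite index type
    both conditions can be stated with sums over the whole type. *)
Lemma basis_of_set_finite (C : fieldType) (H : lmodType C) (V : set H)
    (I : finType) (e : I -> H) :
  basis_of_set V e <->
  [/\ forall i, V (e i),
      forall c : I -> C, \sum_i c i *: e i = 0 -> forall i, c i = 0
    & forall v, V v -> exists c : I -> C, v = \sum_i c i *: e i].
Proof.
split=> -[Ve free span]; split=> //.
- by move=> c c0 i; apply: (free _ c (index_enum_uniq I)) => //; apply: mem_index_enum.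
- move=> v /span[s [c ->]]; elim: s => [|j s [d IHs]].
    by exists (fun=> 0); rewrite big_nil big1 // => i _; rewrite scale0r.
  exists (fun i => (if i == j then c j else 0) + d i).
  rewrite big_cons IHs; under [RHS]eq_bigr do rewrite scalerDl.
  rewrite big_split /=; congr (_ + _).
  by rewrite (bigD1 j) //= eqxx big1 ?addr0 // => i /negPf->; rewrite scale0r.
- move=> s c s_uniq c0 i si.
  have := free (fun i => if i \in s then c i else 0) _ i; rewrite si; apply.
  rewrite -[RHS]c0 [RHS]big_uniq // [RHS]big_mkcond.
  by apply: eq_bigr => k _; case: ifP; rewrite ?scale0r.
- by move=> v /span[c ->]; exists (index_enum I), c.
Qed.

(** A Jordan chain is determined by its last vector [u].  This turns statements
    on ordinal-indexed families into statements on powers of [A - b]. *)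
Lemma jordan_chain_top (C : fieldType) (H : lmodType C) (A : {linear H -> H})
    (b : C) (n : nat) (x : 'I_n -> H) :
  jordan_chain A b x ->
  exists2 u, iter n (sub_scalar A b) u = 0
           & forall j, x j = iter (n - j.+1) (sub_scalar A b) u.
Proof.
case: n x => [x _|n x [x0 xS]]; first by exists 0 => // -[].
have top d (j : 'I_n.+1) : n = (j + d)%N -> x j = iter d (sub_scalar A b) (x ord_max).
  elim: d j => [|d IHd] j; first by rewrite addn0 => nj; congr x; apply/val_inj.
  move=> nj; have lt : (j.+1 < n.+1)%N by lia.
  rewrite iterS -(IHd (Ordinal lt)) /=; last by lia.
  by rewrite (xS j).
exists (x ord_max); first by rewrite iterS -(top n ord0) // x0.
by move=> j; apply: top; rewrite subSS subnKC // -ltnS.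
Qed.

Lemma jordan_chain_iter (C : fieldType) (H : lmodType C) (A : {linear H -> H})
    (b : C) (n : nat) (u : H) :
  iter n (sub_scalar A b) u = 0 ->
  jordan_chain A b (fun j : 'I_n => iter (n - j.+1) (sub_scalar A b) u).
Proof.
move=> un; split=> [j j0|j j' jj']; rewrite -iterS -subSn ?subSS //.
  by rewrite j0 subn0.
by rewrite jj'.
Qed.

Lemma iter_ge_eq0 (C : fieldType) (H : lmodType C) (A : {linear H -> H})
    (n m : nat) (v : H) :
  (n <= m)%N -> iter n A v = 0 -> iter m A v = 0.
Proof. by move=> nm vn; rewrite -(subnK nm) iterD vn linear0. Qed.

(** Applying [A^(p-1)] to the relation kills all terms but the last one, whose
    coefficient is therefore zero; induct on [p]. *)
Lemma iter_free (C : fieldType) (H : lmodType C) (A : {linear H -> H})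
    (n p : nat) (u : H) (c : nat -> C) :
  iter n A u = 0 -> iter n.-1 A u != 0 -> (p <= n)%N ->
  \sum_(r < p) c r *: iter (n - r.+1) A u = 0 ->
  forall r, (r < p)%N -> c r = 0.
Proof.
move=> un u0; elim: p => [//|p IHp] pn; rewrite big_ord_recr /= => sum0.
have cp : c p = 0.
  move/(congr1 (iter p A)): (sum0); rewrite linear0 linearD linear_sum linearZ /=.
  rewrite -iterD (_ : (p + (n - p.+1))%N = n.-1); last by lia.
  rewrite big1 ?add0r => [/eqP|r _].
    by rewrite scaler_eq0 (negPf u0) orbF => /eqP.
  rewrite linearZ /= -iterD (iter_ge_eq0 _ un) ?scaler0 //.
  by have := ltn_ord r; lia.
move: sum0; rewrite cp scale0r addr0 => /(IHp (ltnW pn)) c0 r.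
by rewrite ltnS leq_eqVlt => /predU1P[->|/c0].
Qed.

(** [A^(s-1) v] lies in the kernel, hence equals
    [d A^(n-1) u = A^(s-1) (d A^(n-s) u)]; then [v - d A^(n-s) u] is killed by
    [A^(s-1)], and one inducts on [s]. *)
Lemma iter_ker_span (C : fieldType) (H : lmodType C) (A : {linear H -> H})
    (n s : nat) (u v : H) :
  (forall w, A w = 0 -> exists c, w = c *: iter n.-1 A u) ->
  (s <= n)%N -> iter s A v = 0 ->
  exists c : nat -> C, v = \sum_(r < s) c r *: iter (n - r.+1) A u.
Proof.
move=> ker; elim: s v => [|s IHs] v sn vs; first by exists (fun=> 0); rewrite big_ord0.
have [d vd] := ker _ vs.
have [|c vc] := IHs (v - d *: iter (n - s.+1) A u) (ltnW sn).
  rewrite linearB linearZ /= -iterD (_ : (s + (n - s.+1))%N = n.-1); last by lia.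
  by rewrite -vd subrr.
exists (fun r => if r == s then d else c r); rewrite big_ord_recr /= eqxx.
apply/eqP; rewrite -subr_eq vc; apply/eqP/eq_bigr => r _.
by rewrite ltn_eqF.
Qed.

(** The coordinate-free form of: [N], nilpotent on [V], has a single Jordan
    block of size [n] there, with last basis vector [u].  The last clause makes
    the kernel of [N] at most one-dimensional. *)
Definition single_block (C : fieldType) (H : lmodType C) (N : H -> H)
    (V : set H) (n : nat) (u : H) : Prop :=
  [/\ iter n N u = 0, (0 < n)%N -> iter n.-1 N u != 0,
      forall v, V v -> iter n N v = 0
    & forall v, N v = 0 -> exists c : C, v = c *: iter n.-1 N u].

Lemma single_block_jordan_basis (C : fieldType) (H : lmodType C)
    (A : {linear H -> H}) (b : C) (n : nat) (u : H) :
  single_block (sub_scalar A b) (geigenspace A b) n u ->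
  jordan_basis A b (geigenspace A b)
    (fun j : 'I_n => iter (n - j.+1) (sub_scalar A b) u).
Proof.
move=> [un u0 Vn ker]; split; first exact: jordan_chain_iter.
apply/basis_of_set_finite; split=> [j|c c0 j|v /Vn vn].
- by exists n; rewrite -iterD (iter_ge_eq0 _ un) // leq_addr.
- have n0 := leq_ltn_trans (leq0n j) (ltn_ord j).
  pose d r := oapp c 0 (insub r).
  have dE (i : 'I_n) : d i = c i by rewrite /d valK.
  rewrite -dE; apply: (iter_free un (u0 n0) (leqnn n)) => //.
  by rewrite -[RHS]c0; apply: eq_bigr => i _; rewrite dE.
- have [c ->] := iter_ker_span ker (leqnn n) vn.
  by exists (fun j : 'I_n => c j).
Qed.

Lemma jordan_basis_single_block (C : fieldType) (H : lmodType C)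
    (A : {linear H -> H}) (b : C) (n : nat) (x : 'I_n -> H) :
  jordan_basis A b (geigenspace A b) x ->
  exists u, single_block (sub_scalar A b) (geigenspace A b) n u.
Proof.
move=> [/jordan_chain_top[u un xu] /basis_of_set_finite[_ free span]].
have Vn v : geigenspace A b v -> iter n (sub_scalar A b) v = 0.
  move=> /span[c ->]; rewrite linear_sum big1 // => j _.
  by rewrite linearZ /= xu -iterD (iter_ge_eq0 _ un) ?scaler0 ?leq_addr.
have u0 : (0 < n)%N -> iter n.-1 (sub_scalar A b) u != 0.
  move=> n0; apply/eqP => u0; have /eqP := oner_neq0 C; apply.
  have := free (fun i => (i == Ordinal n0)%:R) _ (Ordinal n0); rewrite eqxx.
  apply; rewrite (bigD1 (Ordinal n0)) //= xu subn1 u0 scaler0 add0r.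
  by rewrite big1 // => i /negPf->; rewrite scale0r.
exists u; split=> // v Nv; have Vv : geigenspace A b v by exists 1.
case: n => [|n] in x un xu free span Vn u0 *.
  by exists 0; rewrite scale0r; apply: Vn.
have [c vc] := span _ Vv; exists (c ord0).
have c0 : forall r, (r < n)%N -> c (inord r.+1) = 0.
  apply: (iter_free (c := fun r => c (inord r.+1)) un (u0 _) (leqnSn n)) => //.
  rewrite -[RHS]Nv vc linear_sum big_ord_recl /= xu linearZ /= -iterS subn1 un.
  rewrite scaler0 add0r.
  apply: eq_bigr => r _; rewrite linearZ /= xu -iterS.
  have rn := ltn_ord r; congr (c _ *: iter _ _ _); last by rewrite lift0; lia.
  by apply: val_inj; rewrite /= inordK // ltnS.
rewrite vc big_ord_recl xu subn1 big1 ?addr0 // => r _.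
have -> : lift ord0 r = inord r.+1 by apply: val_inj; rewrite /= inordK // ltnS.
by rewrite c0 // scale0r.
Qed.

(** Let [u] be the last vector of some Jordan basis and [t] that of the chain
    [z].  As [N^m t = 0], [t] is a combination of the [N^(n-1-r) u] with
    [r < m], so it has the form [N^(n-m) u'].  Moreover [N^(n-1) u'] equals
    [N^(m-1) t = z_0], a nonzero vector of the kernel line, so [u'] generates a
    Jordan basis too, and this basis begins with [z]. *)
Lemma extend_jordan_chain (C : fieldType) (H : lmodType C)
    (A : {linear H -> H}) (b : C) (m : nat) (z : 'I_m -> H) :
  unique_jordan_block A b (geigenspace A b) ->
  jordan_chain A b z -> (forall s : 'I_m, s = 0 :> nat -> z s != 0) ->
  exists (j : nat) (y : 'I_j -> H),
    jordan_basis A b (geigenspace A b)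
      (fun r : 'I_(m + j) =>
         match fintype.split r with inl s => z s | inr t => y t end).
Proof.
move=> [n [w /jordan_basis_single_block[u blk]]] /jordan_chain_top[t tm zt] z0.
set N := sub_scalar A b in blk tm zt *.
have [un u0 Vn ker] := blk.
have t0 : (0 < m)%N -> iter m.-1 N t != 0.
  by move=> m0; have := z0 (Ordinal m0) erefl; rewrite zt subn1.
have mn : (m <= n)%N.
  case: m => // m in z tm zt z0 t0 *; rewrite ltnNge; apply/negP => nm.
  have /eqP := t0 isT; apply; apply: (iter_ge_eq0 nm).
  by apply: Vn; exists m.+1.
(* For an empty chain [t] carries no information and [u'] is [u] itself. *)
have [u' tu'] : exists2 u', single_block N (geigenspace A b) n u'
    & (0 < m)%N -> t = iter (n - m) N u'.
  case: m => [|m] in z tm zt z0 t0 mn *; first by exists u.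
  have [c tc] := iter_ker_span ker mn tm.
  pose u' := \sum_(r < m.+1) c r *: iter (m.+1 - r.+1) N u.
  have tu' : t = iter (n - m.+1) N u'.
    rewrite tc linear_sum; apply: eq_bigr => r _; rewrite linearZ /= -iterD.
    by congr (_ *: iter _ _ _); have := ltn_ord r; lia.
  have topE : iter n.-1 N u' = iter m N t.
    by rewrite tu' -iterD; congr iter; lia.
  have nE : iter n N u' = 0 by rewrite -tm tu' -iterD; congr iter; lia.
  exists u' => //; split=> //; first by rewrite topE => _; apply: t0.
  move=> v /ker[d ->].
  have [e te] : exists e, iter m N t = e *: iter n.-1 N u by apply: ker.
  have e0 : e != 0.
    by apply: contra_neq (t0 isT) => e0; rewrite te e0 scale0r.
  by exists (d / e); rewrite topE te scalerA divfK.
move=> tE; exists (n - m)%N, (fun r => iter (n - (m + r).+1) N u').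
have := @single_block_jordan_basis _ _ A b (m + (n - m)) u'.
rewrite {1}(subnKC mn) => /(_ tu'); congr jordan_basis; apply: funext => r.
case: splitP => s rs; rewrite rs.
  have m0 := leq_ltn_trans (leq0n s) (ltn_ord s).
  rewrite zt tE // -iterD; congr iter; have := ltn_ord s; lia.
by congr iter; lia.
Qed.

(** * Powers of q and the images of Jordan chains *)

(** Each of the three index sets contains [0] and, for every integer [d], one of
    [d] and [- d]; so [q^d a = a] forces [d = 0]. *)
Lemma eigenvalue_orbit_inj (C : fieldType) (q a : C) (J : set int) :
  q != 0 ->
  J = [set i : int | 0 <= i] \/ J = [set i : int | i <= 0] \/ J = setT ->
  (forall i j, J i -> J j -> q ^ i * a = q ^ j * a -> i = j) ->
  forall i j : int, q ^ i * a = q ^ j * a -> i = j.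
Proof.
move=> q0 hJ inj i j; have qu : q \is a GRing.unit by rewrite unitfE.
have shift (m d : int) : q ^ (m + d) * a = q ^ m * a -> q ^ d * a = q ^ 0 * a.
  by rewrite expfzDr // -mulrA => /(mulfI (expfz_neq0 _ q0)); rewrite expr0z mul1r.
have [J0 Jd] : J 0 /\ forall d : int, J d \/ J (- d).
  case: hJ => [|[]] -> //=; split=> // d.
    by case: (leP 0 d) => d0; [left | right]; lia.
    by case: (leP 0 d) => d0; [right | left]; lia.
  by left.
move=> eq_ij; have [Jij|Jji] := Jd (i - j).
  by have := inj _ _ Jij J0 (shift j _ _); rewrite addrC subrK => /(_ eq_ij); lia.
rewrite opprB in Jji.
by have := inj _ _ Jji J0 (shift i _ _); rewrite addrC subrK => /(_ (esym eq_ij)); lia.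
Qed.

(** [(S - q b) T x_j = q T x_(j-1)], and the weights [r^s] with [r q = 1] absorb
    the factor [q]; the first vector is killed since [T x_l = 0], or since [x_1]
    is an eigenvector when [l = 0]. *)
Lemma jordan_chain_image (C : fieldType) (H : lmodType C)
    (S T : {linear H -> H}) (q r b : C) (k l : nat) (hl : (l <= k)%N)
    (x : 'I_k -> H) :
  (forall v, S (T v) = q *: T (S v)) -> r * q = 1 ->
  jordan_chain S b x -> last_null T x l ->
  jordan_chain S (q * b)
    (fun s => r ^+ s *: T (x (cast_ord (subnKC hl) (rshift l s)))).
Proof.
move=> ST rq [x0 xS] [null _]; split=> [s s0|s s' ss'].
  rewrite linearZ /= sub_scalar_qcomm //.
  have [l0|[j lj Tj]] := null; first by rewrite x0 ?linear0 ?scaler0 //= s0 addn0.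
  by rewrite (xS j) ?Tj ?scaler0 //= s0 lj addn0.
rewrite linearZ /= sub_scalar_qcomm // (xS (cast_ord (subnKC hl) (rshift l s))).
  by rewrite scalerA ss' exprSr -mulrA rq mulr1.
by rewrite /= ss' addnS.
Qed.

(** [T x_j = 0] implies [T x_(j-1) = 0], by [q T x_(j-1) = (S - q b) T x_j]. *)
Lemma null_initial_segment (C : fieldType) (H : lmodType C)
    (S T : {linear H -> H}) (q b : C) (k l : nat) (x : 'I_k -> H) :
  q != 0 -> (forall v, S (T v) = q *: T (S v)) ->
  jordan_chain S b x -> last_null T x l ->
  forall j : 'I_k, (j < l)%N -> T (x j) = 0.
Proof.
move=> q0 ST [_ xS] [[->//|[j0 -> Tj0]] _] j; rewrite ltnS => le_j.
have [d dE] : exists d, (j + d)%N = j0 by exists (j0 - j)%N; rewrite subnKC.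
elim: d j {le_j} dE => [|d IHd] j jd.
  by rewrite (_ : j = j0) //; apply: val_inj; rewrite /= -jd addn0.
have lt : (j.+1 < k)%N by have := ltn_ord j0; lia.
rewrite -(xS j (Ordinal lt)) //.
have := sub_scalar_qcomm b (x (Ordinal lt)) ST.
rewrite IHd /=; last by rewrite addSnnS.
by rewrite linear0 => /esym/eqP; rewrite scaler_eq0 (negPf q0) => /eqP.
Qed.

Lemma image_shifted_diag (C : fieldType) (H : lmodType C) (T : H -> H)
    (q r : C) (k l : nat) (hl : (l <= k)%N) (x : 'I_k -> H) (j : nat)
    (y : 'I_j -> H) :
  q * r = 1 -> (forall i : 'I_k, (i < l)%N -> T (x i) = 0) ->
  is_matrix_of T x (extended_image T r x hl y) (shifted_diag q hl j).
Proof.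
move=> qr T0 c; rewrite big_split_ord /= [X in _ + X]big1 ?addr0 => [|t _].
  (* Splitting the column index at [l] selects the left or right block. *)
  have -> : c = cast_ord (subnKC hl) (cast_ord (esym (subnKC hl)) c).
    by rewrite cast_ordKV.
  case: (split_ordP (cast_ord (esym (subnKC hl)) c)) => [s ->|s ->].
    rewrite T0 //= big1 // => t _.
    by rewrite castmxE cast_ord_id cast_ordK block_mxEul mxE scale0r.
  rewrite (bigD1 s) //= castmxE cast_ord_id cast_ordK block_mxEur !mxE eqxx mulr1n.
  rewrite {1}/extended_image (unsplitK (inl s)) scalerA -exprMn qr expr1n scale1r.
  rewrite big1 ?addr0 // => t /negPf ts.
  by rewrite castmxE cast_ord_id cast_ordK block_mxEur !mxE ts mulr0n scale0r.
rewrite castmxE cast_ord_id.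
case: (split_ordP (cast_ord (esym (subnKC hl)) c)) => [s ->|s ->].
  by rewrite block_mxEdl mxE scale0r.
by rewrite block_mxEdr mxE scale0r.
Qed.

Theorem corollary4p8
  (R : realType) (H : completeNormedModType R[i])
  (ip : {dot H for Num.conj}) (hip : forall x : H, `|x| ^+ 2 = ip x x)
  (q : R[i]) (hq : `|q| = 1) (hq1 : q <> 1)
  (J : set int)
  (hJ : J = [set i : int | 0 <= i] \/ J = [set i : int | i <= 0] \/ J = setT)
  (S T : {linear H -> H})
  (hS : bounded_near S (nbhs 0)) (hT : bounded_near T (nbhs 0))
  (hST : forall x, S (T x) = q *: T (S x))
  (alpha : R[i]) (halpha0 : alpha <> 0) (halpha : is_eigenvalue S alpha)
  (heig : forall i, J i -> is_eigenvalue S (q ^ i * alpha))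
  (hdiff : forall i j, J i -> J j -> q ^ i * alpha = q ^ j * alpha -> i = j)
  (hdec : decomposition J (geigenspaces S q alpha))
  (hdiag : block_diagonal_jordan J (geigenspaces S q alpha) S
     (fun i => q ^ i * alpha)) :
  (forall i j, J i -> J j -> i <> j + 1 ->
     forall x, geigenspaces S q alpha j x ->
       block J (geigenspaces S q alpha) T i j x = 0) /\
  (forall i, J (i - 1) -> J i ->
     unique_jordan_block S (q ^ (i - 1) * alpha) (geigenspaces S q alpha (i - 1)) ->
     unique_jordan_block S (q ^ i * alpha) (geigenspaces S q alpha i) ->
     forall (k : nat) (x : 'I_k -> H),
     jordan_basis S (q ^ (i - 1) * alpha) (geigenspaces S q alpha (i - 1)) x ->
     forall (l : nat) (hl : (l <= k)%N), last_null T x l ->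
     (exists (j : nat) (y : 'I_j -> H),
        jordan_basis S (q ^ i * alpha) (geigenspaces S q alpha i)
          (extended_image T (Num.conj q) x hl y)) /\
     (forall (j : nat) (y : 'I_j -> H),
        jordan_basis S (q ^ i * alpha) (geigenspaces S q alpha i)
          (extended_image T (Num.conj q) x hl y) ->
        is_matrix_of (block J (geigenspaces S q alpha) T i (i - 1))
          x (extended_image T (Num.conj q) x hl y) (shifted_diag q hl j))).
Proof.
have q0 : q != 0 by rewrite -normr_eq0 hq oner_eq0.
have qc : q * Num.conj q = 1 by rewrite -normCK hq expr1n.
have inj := eigenvalue_orbit_inj q0 hJ hdiff.
have cS : continuous S by apply/linear_bounded_continuous.
have V0 i : geigenspaces S q alpha i 0 by apply: geigenspace0.
split=> [i j Ji Jj ij x xj|i Ji1 Ji _ blk k x xb l hl xl].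
  rewrite /block (coord_id hdec V0 Jj xj).
  (* [T x] is in the summand of index [j + 1], which may be outside [J]. *)
  apply: (coord_geigenspace_eq0 (a := fun i => q ^ i * alpha) cS hdec Ji _
    (geigenspaces_succ q0 hST xj)).
  by apply: contra_notN ij => /eqP/inj.
have qi : q ^ i * alpha = q * (q ^ (i - 1) * alpha).
  by rewrite -{1}(subrK 1 i) expfzDr // expr1z mulrA (mulrC q).
have [xc xV] := xb; have [Vx _ _] := xV.
split.
  apply: extend_jordan_chain => //.
    by rewrite qi; apply: jordan_chain_image xl; rewrite // mulrC.
  move=> s s0; rewrite s0 scale1r; apply/eqP => /(proj2 xl).
  by rewrite /= s0 addn0 ltnn.
move=> j y _ c.
have Tx : geigenspaces S q alpha i (T (x c)).
  by rewrite -(subrK 1 i); apply: geigenspaces_succ.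
rewrite /block (coord_id hdec V0 Ji1 (Vx c)) (coord_id hdec V0 Ji Tx).
exact: image_shifted_diag qc (null_initial_segment q0 hST xc xl) c.
Qed.
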